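(* Suppose that observations are generated by the process $$\mathbf{z}_c \sim p_{\mathbf{z}_c},\qquad \tilde{\mathbf{z}}_s \sim p_{\tilde{\mathbf{z}}_s},\qquad \mathbf{z}_s = f_{\mathbf{u}}(\tilde{\mathbf{z}}_s),\qquad \mathbf{x} = g(\mathbf{z}_c,\mathbf{z}_s)$$ described in the context, with latent variable $\mathbf{z}=(\mathbf{z}_c,\mathbf{z}_s)\in\mathcal{Z}\subseteq\mathbb{R}^n$ and $n_s$ changing variables $\mathbf{z}_s=(z_1,\dots,z_{n_s})$. Assume: 1. The set $\{\mathbf{z}\in\mathcal{Z} \mid p(\mathbf{z})=0\}$ has measure zero. 2. For each domain $\mathbf{u}$, the density $p_{\mathbf{z}|\mathbf{u}}$ is at least second-order differentiable. 3. Given the domain $\mathbf{u}$, the components of $\mathbf{z}$ are mutually independent: $z_i \perp z_j \mid \mathbf{u}$ for $i,j\in\{1,\dots,n\}$, $i\neq j$, so that $p_{\mathbf{z}|\mathbf{u}}(\mathbf{z}\mid\mathbf{u})=\prod_{i=1}^n p_{\mathbf{z}|\mathbf{u}}(z_i\mid\mathbf{u})$. 4. For any $\mathbf{z}_s\in\mathcal{Z}_s$ there exist $n_s+1$ values $\mathbf{u}_0,\mathbf{u}_1,\dots,\mathbf{u}_{n_s}$ of $\mathbf{u}$ such that the $n_s\times n_s$ matrix whose $(k,i)$ entry ($k,i=1,\dots,n_s$) is $$\phi_i'(k,0):=\frac{\partial \log p_{\mathbf{z}|\mathbf{u}}(z_i\mid\mathbf{u}_k)}{\partial z_i}-\frac{\partial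 \log p_{\mathbf{z}|\mathbf{u}}(z_i\mid\mathbf{u}_0)}{\partial z_i}$$ is invertible. Let $(\hat g,\hat{\mathbf{z}}_c,\hat{\mathbf{z}}_s)$ be an estimated latent process (see context) that matches the observed distribution in every domain, i.e. with $\hat{\mathbf{x}}=\hat g(\hat{\mathbf{z}}_c,\hat{\mathbf{z}}_s)$, $$p_{\mathbf{x}|\mathbf{u}}(\mathbf{x}'\mid\mathbf{u}')=p_{\hat{\mathbf{x}}|\mathbf{u}}(\mathbf{x}'\mid\mathbf{u}')\qquad\text{for all }\mathbf{x}'\in\mathcal{X},\ \mathbf{u}'\in\mathcal{U}.$$ Then $\mathbf{z}_s$ is subspace identifiable: for each $i\in\{1,\dots,n_s\}$ there exists a function $h_i:\mathbb{R}^{n_s}\to\mathbb{R}$ such that $z_{s,i}=h_i(\hat{\mathbf{z}}_s)$.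
   Context: Setting. $\mathcal{U}$ is the set of values of the domain indicator $\mathbf{u}$ (each value is called a domain). The latent variable $\mathbf{z}=(\mathbf{z}_c,\mathbf{z}_s)$ takes values in $\mathcal{Z}\subseteq\mathbb{R}^n$, with invariant variables $\mathbf{z}_c\in\mathcal{Z}_c\subseteq\mathbb{R}^{n_c}$ and changing variables $\mathbf{z}_s\in\mathcal{Z}_s\subseteq\mathbb{R}^{n_s}$, $n=n_c+n_s$. The components of $\mathbf{z}$ are indexed so that $z_1,\dots,z_{n_s}$ are the components $z_{s,1},\dots,z_{s,n_s}$ of $\mathbf{z}_s$ and $z_{n_s+1},\dots,z_n$ are those of $\mathbf{z}_c$. The observation is $\mathbf{x}=g(\mathbf{z})\in\mathcal{X}\subseteq\mathbb{R}^d$ with $d\ge n$, where $g:\mathcal{Z}\to\mathcal{X}$ is invertible and smooth (a $\mathcal{C}^2$ diffeomorphism). The distribution of $\mathbf{z}_c$ does not depend on $\mathbf{u}$, whereas that of $\mathbf{z}_s=f_{\mathbf{u}}(\tilde{\mathbf{z}}_s)$ does: for distinct domains $\mathbf{u}_k\ne\mathbf{u}_l$, $p_{\mathbf{z}_c|\mathbf{u}_k}=p_{\mathbf{z}_c|\mathbf{u}_l}$ and $p_{\mathbf{z}_s|\mathbf{u}_k}\neq p_{\mathbf{z}_s|\mathbf{u}_l}$. The density of $\mathbf{z}$ given $\mathbf{u}$ is $p_{\mathbf{z}|\mathbf{u}}$, and $p_{\mathbf{z}|\mathbf{u}}(z_i\mid\mathbf{u})$ denotes the conditional marginal density of the component $z_i$.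 Estimated latent process. $(\hat g,\hat{\mathbf{z}}_c,\hat{\mathbf{z}}_s)$ is a process of the same form with the same dimensions $n_c,n_s$: $\hat g$ is an invertible $\mathcal{C}^2$ diffeomorphism onto $\mathcal{X}$, the components of $\hat{\mathbf{z}}=(\hat{\mathbf{z}}_c,\hat{\mathbf{z}}_s)$ are mutually independent given $\mathbf{u}$, and the distribution of $\hat{\mathbf{z}}_c$ does not depend on $\mathbf{u}$. True and estimated latents are related by $\mathbf{z}=h(\hat{\mathbf{z}})$ with $h:=g^{-1}\circ\hat g$; statements such as $z_{s,i}=h_i(\hat{\mathbf{z}}_s)$ are understood with respect to this relation.
   Formalization: Added: for each value of ẑ_s, the set of ẑ_c with (ẑ_s, ẑ_c) in the estimated support is connected (the claim fails for disconnected supports); the supports are taken open, and in assumption 4 the marginal densities of z_s at the chosen domains are positive so that the logarithms exist. *)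

(* Defs.v *)
From HB Require Import structures.
From mathcomp Require Import all_boot all_order all_algebra.
From mathcomp Require Import all_classical all_reals all_analysis.

Set Implicit Arguments.
Unset Strict Implicit.
Unset Printing Implicit Defensive.

Import Order.TTheory GRing.Theory Num.Def Num.Theory.
Import numFieldTopology.Exports numFieldNormedType.Exports.

Local Open Scope classical_set_scope.
Local Open Scope ring_scope.

(* Row vectors carry the sigma-algebra generated by the coordinates, i.e. the
   Borel sigma-algebra of R^n (same construction as for [n.-tuple T]). *)
Definition measure_rV_display : measure_display -> measure_display.
Proof. exact. Qed.

Section measurable_rV.
Context {R : realType}.
Variable n : nat.

Let coors : 'I_n -> 'rV[R]_n -> R := fun i x => x ord0 i.

Let rV_set0 : g_sigma_preimage coors set0.
Proof. exact: sigma_algebra0. Qed.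

Let rV_setC A : g_sigma_preimage coors A -> g_sigma_preimage coors (~` A).
Proof. exact: sigma_algebraC. Qed.

Let rV_bigcup (F : _^nat) : (forall i, g_sigma_preimage coors (F i)) ->
  g_sigma_preimage coors (\bigcup_i (F i)).
Proof. exact: sigma_algebra_bigcup. Qed.

HB.instance Definition _ := @isMeasurable.Build
  (measure_rV_display default_measure_display)
  'rV[R]_n (g_sigma_preimage coors) rV_set0 rV_setC rV_bigcup.

End measurable_rV.

Lemma measurable_coord (R : realType) n (i : 'I_n) :
  measurable_fun [set: 'rV[R]_n] (fun v : 'rV[R]_n => v ord0 i).
Proof.
move=> _ Y mY; rewrite setTI; apply: sub_sigma_algebra => /=.
rewrite -bigcup_seq/=; exists i => /=; first by rewrite mem_index_enum.
by exists Y => //; rewrite setTI.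
Qed.

Lemma measurable_fun_coordP d (T : measurableType d) (R : realType) n
    (f : T -> 'rV[R]_n) :
  (forall i, measurable_fun [set: T] (fun x => f x ord0 i)) ->
  measurable_fun [set: T] f.
Proof.
move=> mf; apply: (@measurability _ _ _ _ _ _
    (\big[setU/set0]_(i < n) preimage_set_system setT
       (fun v : 'rV[R]_n => v ord0 i) measurable)) => //.
move=> _ [B + <-]; rewrite -bigcup_seq => -[i _ [C mC <-]].
rewrite !setTI; have := mf i measurableT C mC; rewrite setTI; exact.
Qed.

(* Lebesgue measure on R^n: unit mass on the one point of R^0, and the product
   of the Lebesgue measures of R and R^n, carried along (x, v) |-> x :: v. *)
Section lebesgue_rV.
Variable R : realType.

Definition cons_rV n (xv : measurableTypeR R * 'rV[R]_n) : 'rV[R]_n.+1 :=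
  row_mx (const_mx xv.1 : 'rV_1) xv.2.

Lemma measurable_cons_rV n : measurable_fun setT (@cons_rV n).
Proof.
apply: measurable_fun_coordP => i; rewrite /cons_rV.
case: (split_ordP (i : 'I_(1 + n))) => j ->.
  rewrite [X in measurable_fun _ X](_ : _ = fst); first exact: measurable_fst.
  by apply/funext => xv; rewrite /= (@row_mxEl _ _ 1 n) mxE.
rewrite [X in measurable_fun _ X](_ : _ = (fun v : 'rV[R]_n => v ord0 j) \o snd).
  exact: measurableT_comp (measurable_coord j) measurable_snd.
by apply/funext => xv; rewrite /= (@row_mxEr _ _ 1 n).
Qed.

Definition lebesgue_cons n (mu : {measure set 'rV[R]_n -> \bar R}) :
    {measure set 'rV[R]_n.+1 -> \bar R} :=
  measure_function_pushforward__canonical__measure_function_Measure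
    (lebesgue_measure \x^ mu)%E (@measurable_cons_rV n).

Fixpoint lebesgue_rV n : {measure set 'rV[R]_n -> \bar R} :=
  match n with
  | 0 => dirac (0 : 'rV[R]_0)
  | m.+1 => lebesgue_cons (lebesgue_rV m)
  end.

Lemma lebesgue_rV_box n (A : 'I_n -> set (measurableTypeR R)) :
  (forall i, measurable (A i)) ->
  lebesgue_rV n [set v | forall i, A i (v ord0 i)] =
  (\prod_(i < n) lebesgue_measure (A i))%E.
Proof.
elim: n A => [|n IHn] A mA.
  rewrite big_ord0 /= diracE mem_set//=; by case.
rewrite big_ord_recl -IHn; last by move=> i; exact: mA.
have mB : measurable [set v : 'rV[R]_n | forall i, A (lift ord0 i) (v ord0 i)].
  rewrite [X in measurable X](_ : _ =
    \big[setI/setT]_(i < n) ((fun v : 'rV[R]_n => v ord0 i) @^-1` A (lift ord0 i))).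
    apply: bigsetI_measurable => i _; rewrite -[X in measurable X]setTI.
    by apply: (measurable_coord i) => //; exact: mA.
  rewrite -bigcap_seq; apply/seteqP; split => [v + i _|v vA i]; first exact.
  by apply: (vA i); rewrite /= mem_index_enum.
rewrite -product_measure2E//; congr ((_ \x^ _)%E _).
apply/seteqP; split => [[x v] /= vA|[x v] [/= Ax vA] i].
  split => [|i] /=.
    have := vA ord0; rewrite /cons_rV (_ : ord0 = lshift n (ord0 : 'I_1)); last first.
      exact/val_inj.
    by rewrite (@row_mxEl _ _ 1 n) mxE.
  have := vA (lift ord0 i); rewrite {2}(_ : lift ord0 i = rshift 1 i).
    by rewrite /cons_rV (@row_mxEr _ _ 1 n).
  exact/val_inj.
rewrite /cons_rV /=; case: (split_ordP (i : 'I_(1 + n))) => j ij.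
  by rewrite ij (@row_mxEl _ _ 1 n) mxE (_ : lshift n j = ord0)//; apply/val_inj; rewrite ord1.
rewrite ij (@row_mxEr _ _ 1 n) (_ : rshift 1 j = lift ord0 j)//; exact/val_inj.
Qed.

End lebesgue_rV.

(* A density is relative to the reference measure [mu] on [D]; in particular
   [Y] lies in [D] almost surely when [P] is a probability. *)
Definition has_density d d' (Om : measurableType d) (T : measurableType d')
    (R : realType) (P : probability Om R) (Y : Om -> T)
    (mu : {measure set T -> \bar R}) (D : set T) (p : T -> R) : Prop :=
  [/\ measurable_fun D p,
      (forall y, D y -> 0 <= p y) &
      forall B, measurable B ->
        P (Y @^-1` B) = (\int[mu]_(y in B `&` D) (p y)%:E)%E].

(* Taking some [B i] to be [setT] gives the product rule for subfamilies. *)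
Definition mutually_independent d d' (Om : measurableType d)
    (T : measurableType d') (R : realType) (P : probability Om R) n
    (Y : 'I_n -> Om -> T) : Prop :=
  forall B : 'I_n -> set T, (forall i, measurable (B i)) ->
    P (\bigcap_i (Y i @^-1` B i)) = (\prod_(i < n) P (Y i @^-1` B i))%E.

Section smoothness.
Variable R : realType.

Definition twice_differentiable_on (V W : normedModType R) (A : set V)
    (f : V -> W) : Prop :=
  forall x, A x -> differentiable f x /\ forall v, differentiable ('D_v f) x.

Definition C2_open (V W : normedModType R) (O : set V) (f : V -> W) : Prop :=
  [/\ open O, twice_differentiable_on O f &
      forall v w x, O x -> {for x, continuous ('D_w ('D_v f))}].

(* On a set [A] that need not be open (the image of the mixing map in R^d has
   empty interior when d > n), C^2 means: locally the restriction of a C^2 map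
   defined on an open set of the ambient space. *)
Definition C2_on (V W : normedModType R) (A : set V) (f : V -> W) : Prop :=
  forall x, A x -> exists (O : set V) (F : V -> W),
    [/\ O x, C2_open O F & forall y, A y -> O y -> f y = F y].

Definition C2_diffeo (V W : normedModType R) (A : set V) (B : set W)
    (f : V -> W) : Prop :=
  [/\ set_bij A B f, C2_on A f & C2_on B (pinv A f)].

End smoothness.

(* [lp_prob u] is the conditional probability given the domain [u]. *)
Record latent_process (R : realType) (U : Type) (ns nc d : nat) :=
  LatentProcess {
  lp_display : measure_display ;
  lp_sample : measurableType lp_display ;
  lp_prob : U -> probability lp_sample R ;
  lp_inv : {mfun lp_sample >-> 'rV[R]_nc} ;
  lp_noise : {mfun lp_sample >-> 'rV[R]_ns} ;
  lp_change : U -> {mfun 'rV[R]_ns >-> 'rV[R]_ns} ;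
  lp_support : set 'rV[R]_(ns + nc) ;
  lp_mix : 'rV[R]_(ns + nc) -> 'rV[R]_d }.

Section latent_process_theory.
Context (R : realType) (U : Type) (ns nc d : nat).
Variable M : latent_process R U ns nc d.

Definition changing (u : U) (w : lp_sample M) : 'rV[R]_ns :=
  lp_change M u (lp_noise M w).

(* The changing variables come first. *)
Definition latent (u : U) (w : lp_sample M) : 'rV[R]_(ns + nc) :=
  row_mx (changing u w) (lp_inv M w).

Definition observed (u : U) (w : lp_sample M) : 'rV[R]_d :=
  lp_mix M (latent u w).

Definition component (i : 'I_(ns + nc)) (u : U) (w : lp_sample M) : R :=
  latent u w ord0 i.

Definition changing_support : set 'rV[R]_ns := lsubmx @` lp_support M.

(* The requirements that the true and the estimated process share.  The
   support is open, so that derivatives on it make sense. *)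
Definition well_formed (X : set 'rV[R]_d) : Prop :=
  [/\ open (lp_support M),
      (forall u w, lp_support M (latent u w)),
      (forall u v B, measurable B ->
         lp_prob M u (lp_inv M @^-1` B) = lp_prob M v (lp_inv M @^-1` B)),
      (forall u v B, measurable B ->
         lp_prob M u (lp_noise M @^-1` B) = lp_prob M v (lp_noise M @^-1` B)) &
      C2_diffeo (lp_support M) X (lp_mix M)].

Definition cond_independent (u : U) : Prop :=
  mutually_independent (lp_prob M u) (fun i => component i u).

Definition cond_density (p : U -> 'rV[R]_(ns + nc) -> R) : Prop :=
  forall u, has_density (lp_prob M u) (latent u) (lebesgue_rV R (ns + nc))
    (lp_support M) (p u).

Definition cond_marginal_density (q : U -> 'I_(ns + nc) -> R -> R) : Prop :=
  forall u i, has_density (lp_prob M u) (component i u : _ -> measurableTypeR R)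
    lebesgue_measure setT (q u i).

Definition observed_density (mu : {measure set 'rV[R]_d -> \bar R})
    (X : set 'rV[R]_d) (px : U -> 'rV[R]_d -> R) : Prop :=
  forall u, has_density (lp_prob M u) (observed u) mu X (px u).

End latent_process_theory.

(* h = g^{-1} o ghat, which carries the estimated latents to the true ones. *)
Definition latent_map (R : realType) (U : Type) (ns nc d : nat)
    (M Mhat : latent_process R U ns nc d) :
    'rV[R]_(ns + nc) -> 'rV[R]_(ns + nc) :=
  pinv (lp_support M) (lp_mix M) \o lp_mix Mhat.

(* The (k, i) entry, for k, i = 1, ..., ns, of the matrix of score differences
   between the domains [dom k] and [dom 0]. *)
Definition score_difference (R : realType) (U : Type) (ns nc : nat)
    (q : U -> 'I_(ns + nc) -> R -> R) (dom : 'I_ns.+1 -> U)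
    (zs : 'rV[R]_ns) : 'M[R]_ns :=
  \matrix_(k < ns, i < ns)
    (derive1 (fun t => ln (q (dom (lift ord0 k)) (lshift nc i) t)) (zs ord0 i) -
     derive1 (fun t => ln (q (dom ord0) (lshift nc i) t)) (zs ord0 i)).

(* Main.v *)
(** The law of the estimated latents and the law of the true latents are both
    images of the common law of the observations, so the estimated law of a
    compact set [A] is the integral of [p u] over [h @` A].  The estimated law
    of a small cube is the product of a changing factor and of an invariant
    factor that does not depend on the domain.  Comparing two domains on
    shrinking cubes, the ratio [p u (h z) / p v (h z)] only depends on the
    changing part of [z], with no Jacobian involved.  Differentiating its
    logarithm in an invariant direction [w] makes the derivative of the changing
    part of [h] along [w] a null vector of the matrix of score differences.
    This needs positive densities, which hold on a dense set, and the conclusion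
    extends by continuity; connectedness of the fibres then integrates it. *)
Require Import Defs.
From HB Require Import structures.
From mathcomp Require Import all_boot all_order all_algebra.
From mathcomp Require Import all_classical all_reals all_analysis.
From mathcomp Require Import measurable_realfun ring lra.

Set Implicit Arguments.
Unset Strict Implicit.
Unset Printing Implicit Defensive.

Import Order.TTheory GRing.Theory Num.Def Num.Theory.
Import numFieldTopology.Exports numFieldNormedType.Exports.

Local Open Scope classical_set_scope.
Local Open Scope ring_scope.

(** * Boxes, measurability and Lebesgue measure in ['rV[R]_n] *)

Lemma rV_ballE {R : realType} n (x y : 'rV[R]_n) e :
  ball x e y <-> 0 < e /\ forall i, `|x ord0 i - y ord0 i| < e.
Proof.
split=> [[e0 xy]|[e0 xy]]; split=> //.
  by move=> i; exact: xy.
by move=> i j; rewrite (ord1 i); exact: xy.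
Qed.

Lemma measurable_cylinder {R : realType} n
    (A : 'I_n -> set (measurableTypeR R)) :
  (forall i, measurable (A i)) ->
  measurable [set v : 'rV[R]_n | forall i, A i (v ord0 i)].
Proof.
move=> mA; rewrite [X in measurable X](_ : _ =
    \big[setI/setT]_(i < n) ((fun v : 'rV[R]_n => v ord0 i) @^-1` A i)).
  apply: bigsetI_measurable => i _; rewrite -[X in measurable X]setTI.
  by apply: (measurable_coord i) => //; exact: mA.
rewrite -bigcap_seq; apply/seteqP; split => [v vA i _|v vA i] /=; first exact: vA.
by apply: (vA i); rewrite /= mem_index_enum.
Qed.

(** Second countability: an open set is the union of the countably many boxes with rational centre
    and radius [1 / (k + 1)] that it contains. *)
Lemma open_measurable_rV {R : realType} n (O : set 'rV[R]_n) :
  open O -> measurable O.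
Proof.
move=> oO.
pose B (c : 'rV[rat]_n * nat) : set 'rV[R]_n :=
  [set v | forall i, `](ratr (c.1 ord0 i) - c.2.+1%:R^-1 : R),
                       (ratr (c.1 ord0 i) + c.2.+1%:R^-1)[%classic (v ord0 i)].
rewrite (_ : O = \bigcup_(c in [set c | B c `<=` O]) B c); last first.
  apply/seteqP; split=> [x Ox|x [c /= cO]]; last exact: cO.
  have /nbhs_ballP[e /= e0 xeO] := open_nbhs_nbhs (conj oO Ox).
  (* A radius below [e / 2]: the centre is within one radius of [x] and the points of the box within
     one radius of the centre, so the box stays in the ball. *)
  have [k _ ke] := near_infty_natSinv_lt (PosNum (divr_gt0 e0 (@ltr0n R 2))).
  have {}ke := ke k (leqnn k).
  have k0 : 0 < (k.+1%:R^-1 : R) by rewrite invr_gt0.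
  have ex i : exists c : rat, ratr c \in
      `](x ord0 i - k.+1%:R^-1), (x ord0 i + k.+1%:R^-1)[.
    by apply: rat_in_itvoo; rewrite ltrBlDr -addrA ltrDl addr_gt0.
  have [f fP] := choice ex.
  exists (\row_i f i, k) => /=.
    move=> y By; apply: xeO; apply/rV_ballE; split=> // i.
    have := By i; have := fP i; rewrite /= mxE !in_itv /= => /andP[a1 a2] /andP[b1 b2].
    move: ke => /=; set r := _^-1 in a1 a2 b1 b2 * => re.
    rewrite ltr_norml; apply/andP; split; lra.
  move=> i; have := fP i; rewrite /= mxE !in_itv /= => /andP[].
  set r := _^-1; set c := ratr _ => a1 a2; apply/andP; split; [lra|lra].
rewrite bigcup_mkcond; apply: countable_bigcupT_measurable => [|c].
  exact: (@countableP (('rV[rat]_n * nat)%type : countType)).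
case: ifP => _; last exact: measurable0.
apply: (@measurable_cylinder _ n (fun i =>
  `](ratr (c.1 ord0 i) - c.2.+1%:R^-1),
    (ratr (c.1 ord0 i) + c.2.+1%:R^-1)[%classic)) => i.
exact: measurable_itv.
Qed.

Lemma compact_measurable_rV {R : realType} n (A : set 'rV[R]_n) :
  compact A -> measurable A.
Proof.
move=> cA; rewrite -(setCK A); apply: measurableC; apply: open_measurable_rV.
by apply: closed_openC; apply: compact_closed => //; exact: norm_hausdorff.
Qed.

Lemma lebesgue_rV_open_gt0 {R : realType} n (O : set 'rV[R]_n) :
  open O -> O !=set0 -> (0 < lebesgue_rV R n O)%E.
Proof.
move=> oO [x Ox].
have /nbhs_ballP[e /= e0 xeO] := open_nbhs_nbhs (conj oO Ox).
pose A i : set (measurableTypeR R) :=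
  `](x ord0 i - e), (x ord0 i + e)[%classic.
have mA i : measurable (A i) by exact: measurable_itv.
apply: (@lt_le_trans _ _ (lebesgue_rV R n [set v | forall i, A i (v ord0 i)])).
  rewrite lebesgue_rV_box// (eq_bigr (fun=> (e + e)%:E)); last first.
    move=> i _; rewrite lebesgue_measure_itv /= lte_fin ifT; last first.
      by rewrite ltrBlDr -addrA ltrDl addr_gt0.
    by rewrite -EFinD; congr (_%:E); ring.
  by rewrite prodEFin lte_fin prodr_gt0// => i _; rewrite addr_gt0.
apply: le_measure; rewrite ?inE.
- exact: measurable_cylinder.
- exact: open_measurable_rV.
move=> v Av; apply: xeO; apply/rV_ballE; split=> // i.
have := Av i; rewrite /A /= in_itv /= => /andP[a1 a2].
by rewrite ltr_norml; apply/andP; split; lra.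
Qed.

(** Turns the first assumption into a density statement: nonempty open sets have positive measure,
    so a null set cannot contain one. *)
Lemma negligible_open_rV {R : realType} n (N O : set 'rV[R]_n) :
  (lebesgue_rV R n).-negligible N -> open O -> O !=set0 -> exists2 x, O x & ~ N x.
Proof.
move=> [B [mB B0 NB]] oO O0; apply: contrapT => H.
have OB : O `<=` B.
  by move=> x Ox; apply: NB; apply: contrapT => Nx; apply: H; exists x.
have := lebesgue_rV_open_gt0 oO O0; rewrite ltNge => /negP; apply.
by rewrite -B0; apply: le_measure; rewrite ?inE//; exact: open_measurable_rV.
Qed.

(** Closed, so that its continuous images are compact and hence measurable; a product of intervals,
    so that independence factors its probability. *)
Definition cube {R : realType} n (x : 'rV[R]_n) (e : R) : set 'rV[R]_n :=
  [set v | forall i, `[(x ord0 i - e), (x ord0 i + e)]%classic (v ord0 i)].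

Lemma compact_cube {R : realType} n (x : 'rV[R]_n) e : compact (cube x e).
Proof.
apply: (@rV_compact _ _ (fun i => `[(x ord0 i - e), (x ord0 i + e)]%classic)).
by move=> i; exact: segment_compact.
Qed.

Lemma ball_cube {R : realType} n (x : 'rV[R]_n) e : ball x e `<=` cube x e.
Proof.
move=> v /rV_ballE[e0 xv] i; have := xv i.
by rewrite ltr_norml /= in_itv /= => /andP[? ?]; apply/andP; split; lra.
Qed.

Lemma nbhs_cube {R : realType} n (x : 'rV[R]_n) (A : set 'rV[R]_n) :
  nbhs x A -> exists2 e, 0 < e & forall e', e' <= e -> cube x e' `<=` A.
Proof.
move=> /nbhs_ballP[e /= e0 xeA]; exists (e / 2); first by rewrite divr_gt0.
move=> e' ee' v xv; apply: xeA; apply/rV_ballE; split=> // i.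
have := xv i; rewrite /= in_itv /= => /andP[a1 a2].
by rewrite ltr_norml; apply/andP; split; lra.
Qed.

(** * Composition of [C2_on] maps *)

Section twice_differentiable_composition.
Variable R : realType.

Lemma derive_row_sum (W : normedModType R) n (f : 'rV[R]_n -> W) x w :
  differentiable f x ->
  'D_w f x = \sum_j w ord0 j *: 'D_(delta_mx ord0 j) f x.
Proof.
move=> df; rewrite deriveE// {1}[w]row_sum_delta linear_sum.
by apply: eq_bigr => j _; rewrite linearZ/= deriveE.
Qed.

(** Meant for [f] a mixing map and [k] the inverse of another one, where [B] is the image in R^d and
    may have empty interior. Since [A] is open, [k \o f] agrees near [x] with the composite [K \o F]
    of the ambient extensions, and all derivatives are computed there. *)
Lemma C2_on_comp (V : normedModType R) m (Z : normedModType R)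
    (A : set V) (B : set 'rV[R]_m) (f : V -> 'rV[R]_m) (k : 'rV[R]_m -> Z) x :
  open A -> (forall y, A y -> B (f y)) -> C2_on A f -> C2_on B k -> A x ->
  [/\ {for x, continuous (k \o f)},
      (forall w, \forall y \near x, derivable (k \o f) y w) &
      forall w, {for x, continuous ('D_w (k \o f))}].
Proof.
move=> oA AB C2f C2k Ax.
have [Q [F [Ox [oO dF cF] fF]]] := C2f x Ax.
have [P [K [PFx [oP dK cK] kK]]] := C2k _ (AB _ Ax).
have AOx : nbhs x (A `&` Q) by apply: filterI; exact: open_nbhs_nbhs.
have fFx : f x = F x by exact: fF.
have cFx y : Q y -> {for y, continuous F}.
  by move=> Oy; apply: differentiable_continuous; exact: (dF y Oy).1.
have PFx' : nbhs (F x) P by rewrite -fFx; exact: open_nbhs_nbhs.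
have FP : nbhs x (F @^-1` P) by exact: (cFx x Ox).
have near_eq : \forall y \near x, [/\ Q y, P (F y) & k (f y) = K (F y)].
  near=> y.
  have [Ay Oy] : (A `&` Q) y by near: y.
  have Py : P (F y) by near: y.
  split=> //; rewrite -(fF _ Ay Oy); apply: kK; first exact: AB.
  by rewrite fF.
(* A derivative at [y] sees a whole neighbourhood of [y], so the identity is needed around each
   nearby [y]; the interior provides this. *)
have near2_eq : \forall y \near x,
    [/\ Q y, P (F y) & \forall z \near y, k (f z) = K (F z)].
  apply: filterS (nbhs_interior near_eq) => y Hy.
  have [Oy Py _] := nbhs_singleton Hy.
  by split => //; apply: filterS Hy => z [].
split.
- have cKF : {for x, continuous (K \o F)}.
    apply: continuous_comp; first exact: cFx.
    by apply: differentiable_continuous; apply: (dK _ _).1; exact: nbhs_singleton.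
  have [_ _ Ex] := nbhs_singleton near_eq.
  rewrite /prop_for /continuous_at /= Ex.
  apply: cvg_trans cKF; apply: near_eq_cvg.
  by apply: filterS near_eq => y [].
- move=> w; apply: filterS near2_eq => y [Oy Py Ey].
  apply: (@near_eq_derivable _ _ _ (K \o F)).
    by apply: filterS Ey => z /= ->.
  apply: diff_derivable.
  by apply: differentiable_comp; [exact: (dF _ Oy).1|exact: (dK _ Py).1].
- move=> w.
(* The chain rule written in coordinates, so that continuity reduces to that of each factor. *)
pose D y := \sum_j ('D_w F y) ord0 j *: 'D_(delta_mx ord0 j) K (F y).
have DE : \forall y \near x, D y = 'D_w (k \o f) y.
  apply: filterS near2_eq => y [Oy Py Ey].
  rewrite (near_eq_derive w Ey).
  have dFy := (dF _ Oy).1; have dKy := (dK _ Py).1.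
  rewrite [RHS]deriveE; last exact: differentiable_comp.
  by rewrite diff_comp//= -deriveE// -deriveE// derive_row_sum.
have cD : {for x, continuous D}.
  rewrite /continuous_at /D.
  apply: (cvg_big add_continuous) => j _.
  apply: cvgZ.
    apply: (@continuous_comp _ _ _ ('D_w F) (fun v : 'rV[R]_m => v ord0 j)).
      by apply: differentiable_continuous; exact: (dF _ Ox).2.
    exact: coord_continuous.
  apply: (@continuous_comp _ _ _ F ('D_(delta_mx ord0 j) K)).
    exact: cFx.
  apply: differentiable_continuous; apply: (dK _ _).2.
  exact: (nbhs_singleton PFx').
rewrite /prop_for /continuous_at -(nbhs_singleton DE).
by apply: cvg_trans cD; apply: near_eq_cvg.
Unshelve. all: by end_near. Qed.

Lemma C2_on_continuous (V W : normedModType R) (A : set V) (f : V -> W) x :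
  open A -> C2_on A f -> A x -> {for x, continuous f}.
Proof.
move=> oA C2f Ax; have [Q [F [Qx [oQ dF _] fF]]] := C2f x Ax.
have AQx : nbhs x (A `&` Q) by apply: filterI; exact: open_nbhs_nbhs.
have cF : {for x, continuous F}.
  by apply: differentiable_continuous; exact: (dF x Qx).1.
rewrite /prop_for /continuous_at (fF _ Ax Qx).
apply: cvg_trans cF; apply: near_eq_cvg.
by apply: filterS AQx => y [Ay Qy]; rewrite fF.
Qed.

End twice_differentiable_composition.

(** * The latent map [h] as a C^1 homeomorphism between the supports *)

Section latent_map_theory.
Context (R : realType) (U : Type) (ns nc d : nat) (X : set 'rV[R]_d).
Variables M N : latent_process R U ns nc d.
Hypotheses (Mwf : well_formed M X) (Nwf : well_formed N X).

Lemma lp_mix_sub z : lp_support N z -> X (lp_mix N z).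
Proof. by case: Nwf => _ _ _ _ [[+ _ _] _ _]; apply. Qed.

Lemma latent_map_sub z : lp_support N z -> lp_support M (latent_map M N z).
Proof.
move=> /lp_mix_sub Xz; case: Mwf => _ _ _ _ [bij _ _].
have [sub _ _] : set_bij X (lp_support M) (pinv (lp_support M) (lp_mix M)).
  exact: bijpinv_bij.
exact: sub.
Qed.

Lemma latent_mapE z : lp_support N z -> lp_mix M (latent_map M N z) = lp_mix N z.
Proof.
move=> /lp_mix_sub Xz; case: Mwf => _ _ _ _ [[_ _ surj] _ _].
by rewrite /latent_map /= (surjpK _ surj)// inE.
Qed.

Lemma latent_map_C1 z : lp_support N z ->
  [/\ {for z, continuous (latent_map M N)},
      (forall w, \forall y \near z, derivable (latent_map M N) y w) &
      forall w, {for z, continuous ('D_w (latent_map M N))}].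
Proof.
move=> Nz; have [oN _ _ _ [_ C2N _]] := Nwf; have [_ _ _ _ [_ _ C2M]] := Mwf.
exact: (C2_on_comp oN lp_mix_sub C2N C2M Nz).
Qed.

Lemma latent_map_continuous z : lp_support N z ->
  {for z, continuous (latent_map M N)}.
Proof.
by move=> Nz; have [] := latent_map_C1 Nz.
Qed.

Lemma lp_mix_continuous z : lp_support N z -> {for z, continuous (lp_mix N)}.
Proof.
move=> Nz; have [oN _ _ _ [_ C2N _]] := Nwf.
exact: (C2_on_continuous oN C2N Nz).
Qed.

End latent_map_theory.

Section latent_map_inverse.
Context (R : realType) (U : Type) (ns nc d : nat) (X : set 'rV[R]_d).
Variables M N : latent_process R U ns nc d.
Hypotheses (Mwf : well_formed M X) (Nwf : well_formed N X).

Lemma latent_mapK z : lp_support N z -> latent_map N M (latent_map M N z) = z.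
Proof.
move=> Nz; have Mhz := latent_map_sub Mwf Nwf Nz.
have [_ _ _ _ [[_ inj _] _ _]] := Nwf.
apply: inj; rewrite ?inE//; first exact: (latent_map_sub Nwf Mwf).
by rewrite (latent_mapE Nwf Mwf Mhz) (latent_mapE Mwf Nwf Nz).
Qed.

End latent_map_inverse.

Section latent_map_homeomorphism.
Context (R : realType) (U : Type) (ns nc d : nat) (X : set 'rV[R]_d).
Variables M N : latent_process R U ns nc d.
Hypotheses (Mwf : well_formed M X) (Nwf : well_formed N X).

(** The inverse of [h] is the latent map with the two processes exchanged; it is continuous, so the
    image of an open set is a preimage under a continuous map. *)
Lemma latent_map_open (O : set 'rV[R]_(ns + nc)) : open O ->
  O `<=` lp_support N -> open (latent_map M N @` O).
Proof.
move=> oO ON; rewrite openE => _ [z Oz <-].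
have Nz := ON _ Oz; have Mhz := latent_map_sub Mwf Nwf Nz.
have : nbhs (latent_map M N z) (lp_support M `&` (latent_map N M @^-1` O)).
  have [oM _ _ _ _] := Mwf.
  apply: filterI; first by apply: open_nbhs_nbhs; split.
  apply: (latent_map_continuous Nwf Mwf Mhz).
  by rewrite (latent_mapK Mwf Nwf Nz); apply: open_nbhs_nbhs; split.
apply: filterS => y [My /= Oy]; exists (latent_map N M y) => //.
exact: (latent_mapK Nwf Mwf).
Qed.

Lemma latent_map_compact (A : set 'rV[R]_(ns + nc)) : compact A ->
  A `<=` lp_support N -> compact (latent_map M N @` A).
Proof.
move=> cA AN; apply: continuous_compact => //.
apply: continuous_in_subspaceT => z; rewrite inE => /AN Nz.
exact: (latent_map_continuous Mwf Nwf).
Qed.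

Lemma lp_mix_compact (A : set 'rV[R]_(ns + nc)) : compact A ->
  A `<=` lp_support N -> compact (lp_mix N @` A).
Proof.
move=> cA AN; apply: continuous_compact => //.
apply: continuous_in_subspaceT => z; rewrite inE => /AN Nz.
exact: (lp_mix_continuous Nwf).
Qed.

End latent_map_homeomorphism.

(** * The estimated law as an integral of the true density *)

Section latent_law.
Context (R : realType) (U : Type) (ns nc d : nat) (X : set 'rV[R]_d).
Variables M N : latent_process R U ns nc d.
Hypotheses (Mwf : well_formed M X) (Nwf : well_formed N X).
Variable p : U -> 'rV[R]_(ns + nc) -> R.
Hypothesis p_density : cond_density M p.
Variable mu : {measure set 'rV[R]_d -> \bar R}.
Variables px pxhat : U -> 'rV[R]_d -> R.
Hypothesis px_density : observed_density M mu X px.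
Hypothesis pxhat_density : observed_density N mu X pxhat.
Hypothesis matching : forall (x : 'rV[R]_d) (u : U), X x -> px u x = pxhat u x.

(* Passing through the observations, whose laws agree, replaces the change of
   variables formula. *)
Lemma latent_law u (A : set 'rV[R]_(ns + nc)) : compact A ->
  A `<=` lp_support N ->
  lp_prob N u (@latent _ _ _ _ _ N u @^-1` A) =
  (\int[lebesgue_rV R (ns + nc)]_(z in latent_map M N @` A) (p u z)%:E)%E.
Proof.
move=> cA AN.
have mgA := compact_measurable_rV (lp_mix_compact Nwf cA AN).
have mhA := compact_measurable_rV (latent_map_compact Mwf Nwf cA AN).
have [oN Nlat _ _ [[_ injN _] _ _]] := Nwf.
have [oM Mlat _ _ [[_ injM _] _ _]] := Mwf.
have -> : @latent _ _ _ _ _ N u @^-1` A = @observed _ _ _ _ _ N u @^-1` (lp_mix N @` A).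
  apply/seteqP; split=> [w Aw|w [z Az zw]] /=; first by exists (latent u w).
  suff <- : z = latent u w by [].
  by apply: injN; rewrite ?inE//; exact: AN.
have [_ _ ->//] := pxhat_density u.
transitivity (\int[mu]_(y in (lp_mix N @` A) `&` X) (px u y)%:E)%E.
  by apply: eq_integral => y; rewrite inE => -[_ Xy]; rewrite matching.
have [_ _ <-//] := px_density u.
have [_ _ H] := p_density u.
have -> : latent_map M N @` A = (latent_map M N @` A) `&` lp_support M.
  apply/esym/setIidl => _ [z Az <-]; exact: (latent_map_sub Mwf Nwf (AN _ Az)).
rewrite -H//; congr (lp_prob M u _).
apply/seteqP; split=> [w [z Az zw]|w [z Az zw]] /=; exists z => //=.
  apply: injM; rewrite ?inE//; first exact: (latent_map_sub Mwf Nwf (AN _ Az)).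
  by rewrite (latent_mapE Mwf Nwf (AN _ Az)).
by rewrite -(latent_mapE Mwf Nwf (AN _ Az)) zw.
Qed.

Lemma measurable_density_compact (u : U) (A : set 'rV[R]_(ns + nc)) : compact A ->
  A `<=` lp_support M -> measurable_fun A (EFin \o p u).
Proof.
move=> cA AM; apply/measurable_EFinP; have [mp _ _] := p_density u.
apply: measurable_funS mp => //; apply: open_measurable_rV.
by have [] := Mwf.
Qed.

Lemma latent_law_le u v (A : set 'rV[R]_(ns + nc)) a b : compact A ->
  A `<=` lp_support N -> 0 <= a -> 0 <= b ->
  (forall z, A z -> a * p u (latent_map M N z) <= b * p v (latent_map M N z)) ->
  (a%:E * lp_prob N u (@latent _ _ _ _ _ N u @^-1` A) <=
   b%:E * lp_prob N v (@latent _ _ _ _ _ N v @^-1` A))%E.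
Proof.
move=> cA AN a0 b0 puv.
have chA := latent_map_compact Mwf Nwf cA AN.
have mhA := compact_measurable_rV chA.
have hAM : latent_map M N @` A `<=` lp_support M.
  by move=> _ [z Az <-]; exact: (latent_map_sub Mwf Nwf (AN _ Az)).
have p0 w z : (latent_map M N @` A) z -> (0 <= (p w z)%:E)%E.
  by move=> hAz; rewrite lee_fin; have [_ + _] := p_density w; apply; exact: hAM.
have mp w : measurable_fun (latent_map M N @` A) (EFin \o p w).
  exact: measurable_density_compact.
rewrite !latent_law// -(ge0_integralZl_EFin _ mhA (p0 u) (mp u) a0).
rewrite -(ge0_integralZl_EFin _ mhA (p0 v) (mp v) b0).
apply: ge0_le_integral => //.
- by move=> z Az; rewrite mule_ge0 ?lee_fin//; have := p0 u _ Az; rewrite lee_fin.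
- by apply: measurable_funeM; exact: mp.
- by apply: measurable_funeM; exact: mp.
by move=> _ [z Az <-]; rewrite -!EFinM lee_fin puv.
Qed.

Lemma latent_law_gt0 u (A : set 'rV[R]_(ns + nc)) c : compact A ->
  A `<=` lp_support N -> A° !=set0 -> 0 < c ->
  (forall z, A z -> c <= p u (latent_map M N z)) ->
  (0 < lp_prob N u (@latent _ _ _ _ _ N u @^-1` A))%E.
Proof.
move=> cA AN A0 c0 cp.
have chA := latent_map_compact Mwf Nwf cA AN.
have mhA := compact_measurable_rV chA.
have hAM : latent_map M N @` A `<=` lp_support M.
  by move=> _ [z Az <-]; exact: (latent_map_sub Mwf Nwf (AN _ Az)).
rewrite latent_law//.
apply: (@lt_le_trans _ _
  (\int[lebesgue_rV R (ns + nc)]_(z in latent_map M N @` A) (cst c%:E z))%E).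
  rewrite integral_cst//; apply: mule_gt0; first by rewrite lte_fin.
  have oI := @open_interior _ A.
  have hoI := latent_map_open Mwf Nwf oI (subset_trans (@interior_subset _ A) AN).
  apply: (@lt_le_trans _ _ (lebesgue_rV R (ns + nc) (latent_map M N @` A°))).
    apply: lebesgue_rV_open_gt0 => //.
    by have [z Az] := A0; exists (latent_map M N z), z.
  apply: le_measure; rewrite ?inE//; first exact: open_measurable_rV.
  by apply: image_subset; exact: interior_subset.
apply: ge0_le_integral => //.
- by move=> z _; rewrite lee_fin ltW.
- exact: (measurable_density_compact u chA hAM).
by move=> _ [z Az <-]; rewrite lee_fin cp.
Qed.

End latent_law.

(** * Factorization of the estimated law of a cube *)

Section latent_cubes.
Context (R : realType) (U : Type) (ns nc d : nat) (X : set 'rV[R]_d).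
Variable N : latent_process R U ns nc d.
Hypotheses (Nwf : well_formed N X) (N_indep : forall u, cond_independent N u).

Lemma measurable_component u i :
  measurable_fun setT (@component _ _ _ _ _ N i u).
Proof.
rewrite /component /latent; case: (split_ordP i) => j ->.
  rewrite (_ : (fun _ => _) = (fun v : 'rV[R]_ns => v ord0 j) \o
      (lp_change N u \o lp_noise N)).
    apply: measurableT_comp; first exact: measurable_coord.
    exact: measurableT_comp.
  by apply/funext => w /=; rewrite row_mxEl.
rewrite (_ : (fun _ => _) = (fun v : 'rV[R]_nc => v ord0 j) \o lp_inv N).
  by apply: measurableT_comp; first exact: measurable_coord.
by apply/funext => w /=; rewrite row_mxEr.
Qed.

Lemma invariant_component u v j B : measurable B ->
  lp_prob N u (@component _ _ _ _ _ N (rshift ns j) u @^-1` B) =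
  lp_prob N v (@component _ _ _ _ _ N (rshift ns j) v @^-1` B).
Proof.
move=> mB; have [_ _ inv _ _] := Nwf.
have E w : @component _ _ _ _ _ N (rshift ns j) w @^-1` B =
    lp_inv N @^-1` ((fun v : 'rV[R]_nc => v ord0 j) @^-1` B).
  by apply/seteqP; split=> x /=; rewrite /component /latent row_mxEr.
rewrite !E; apply: inv; rewrite -[X in measurable X]setTI.
exact: measurable_coord.
Qed.

Definition changing_mass u (zs : 'rV[R]_ns) (e : R) : R :=
  \prod_(i < ns) fine (lp_prob N u (@component _ _ _ _ _ N (lshift nc i) u @^-1`
    `[(zs ord0 i - e), (zs ord0 i + e)]%classic)).

Definition invariant_mass u (zc : 'rV[R]_nc) (e : R) : R :=
  \prod_(j < nc) fine (lp_prob N u (@component _ _ _ _ _ N (rshift ns j) u @^-1`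
    `[(zc ord0 j - e), (zc ord0 j + e)]%classic)).

Lemma invariant_mass_domain u v zc e :
  invariant_mass u zc e = invariant_mass v zc e.
Proof.
by apply: eq_bigr => j _; rewrite (invariant_component u v).
Qed.

Lemma changing_mass_ge0 u zs e : 0 <= changing_mass u zs e.
Proof. by apply: prodr_ge0 => i _; rewrite fine_ge0. Qed.

Lemma invariant_mass_ge0 u zc e : 0 <= invariant_mass u zc e.
Proof. by apply: prodr_ge0 => i _; rewrite fine_ge0. Qed.

Lemma latent_cube u z e :
  lp_prob N u (@latent _ _ _ _ _ N u @^-1` cube z e) =
  (changing_mass u (lsubmx z) e * invariant_mass u (rsubmx z) e)%:E.
Proof.
pose B i : set R := `[(z ord0 i - e), (z ord0 i + e)]%classic.
have -> : @latent _ _ _ _ _ N u @^-1` cube z e =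
    \bigcap_i (@component _ _ _ _ _ N i u @^-1` B i).
  by apply/seteqP; split=> [w zw i _|w zw i]; [exact: zw|exact: zw].
rewrite N_indep => [|i]; last exact: measurable_itv.
rewrite big_split_ord /= EFinM /changing_mass /invariant_mass -!prodEFin.
have fin i : lp_prob N u (@component _ _ _ _ _ N i u @^-1` B i) \is a fin_num.
  apply: fin_num_measure; rewrite -[X in measurable X]setTI.
  by apply: measurable_component => //; exact: measurable_itv.
congr (_ * _)%E; apply: eq_bigr => i _; rewrite !mxE.
  by rewrite -[LHS](fineK (fin _)).
by rewrite -[LHS](fineK (fin _)).
Qed.

End latent_cubes.

(** * The density ratio of two domains depends only on the changing estimated latents *)

Section density_ratio.
Context (R : realType) (U : Type) (ns nc d : nat) (X : set 'rV[R]_d).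
Variables M N : latent_process R U ns nc d.
Hypotheses (Mwf : well_formed M X) (Nwf : well_formed N X).
Variable p : U -> 'rV[R]_(ns + nc) -> R.
Hypothesis p_density : cond_density M p.
Hypothesis p_smooth : forall u, twice_differentiable_on (lp_support M) (p u).
Hypothesis N_indep : forall u, cond_independent N u.
Variable mu : {measure set 'rV[R]_d -> \bar R}.
Variables px pxhat : U -> 'rV[R]_d -> R.
Hypothesis px_density : observed_density M mu X px.
Hypothesis pxhat_density : observed_density N mu X pxhat.
Hypothesis matching : forall (x : 'rV[R]_d) (u : U), X x -> px u x = pxhat u x.

Let h := latent_map M N.

Lemma density_latent_map_continuous u z : lp_support N z ->
  {for z, continuous (p u \o h)}.
Proof.
move=> Nz; apply: continuous_comp; first exact: (latent_map_continuous Mwf Nwf).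
apply: differentiable_continuous; apply: (p_smooth _ _).1.
exact: (latent_map_sub Mwf Nwf).
Qed.

Lemma near_density_lt u v z a b : lp_support N z ->
  a * p u (h z) < b * p v (h z) ->
  \forall y \near z, a * p u (h y) <= b * p v (h y).
Proof.
move=> Nz ab.
have c w k : {for z, continuous (fun y => k * p w (h y))}.
  apply: (@continuousM _ _ (cst k) (p w \o h)); first exact: cst_continuous.
  exact: density_latent_map_continuous.
(* The midpoint separates the two sides, so each can be controlled by its own continuity. *)
pose m := (a * p u (h z) + b * p v (h z)) / 2.
have am : a * p u (h z) < m by rewrite /m; lra.
have mb : m < b * p v (h z) by rewrite /m; lra.
near=> y; apply: ltW; apply: (@lt_trans _ _ m); near: y.
  exact: (c u a _ (lt_nbhsl am)).
exact: (c v b _ (lt_nbhsr mb)).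
Unshelve. all: by end_near. Qed.

Lemma near_density_gt0 v z : lp_support N z -> 0 < p v (h z) ->
  \forall y \near z, p v (h z) / 2 <= p v (h y).
Proof.
move=> Nz pz0.
have c : {for z, continuous (p v \o h)}.
  exact: density_latent_map_continuous.
near=> y; apply: ltW; near: y; apply: (c _ (lt_nbhsr _)).
by rewrite /= ltr_pdivrMr// ltr_pMr// ltr1n.
Unshelve. all: by end_near. Qed.

(** Gives one threshold for all small radii, so that cubes about two different points can later be
    given the same radius. The mass is positive because the density stays above half its value at
    the centre. *)
Lemma near_cube_mass z (Q : 'rV[R]_(ns + nc) -> Prop) v :
  lp_support N z -> 0 < p v (h z) -> (\forall y \near z, Q y) ->
  exists2 e0, 0 < e0 & forall e, 0 < e -> e <= e0 ->
    [/\ cube z e `<=` lp_support N,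
        (forall y, cube z e y -> Q y) &
        0 < changing_mass N v (lsubmx z) e * invariant_mass N v (rsubmx z) e].
Proof.
move=> Nz pz0 nQ.
have nN : nbhs z (lp_support N).
  by apply: open_nbhs_nbhs; split=> //; case: Nwf.
have [e0 e00 H] := nbhs_cube (filterI (filterI nN nQ) (near_density_gt0 Nz pz0)).
exists e0 => // e e_gt0 ee0.
have cN : cube z e `<=` lp_support N by move=> y /H -/(_ ee0)[[]].
split=> //; first by move=> y /H -/(_ ee0)[[]].
rewrite -lte_fin -(latent_cube N_indep).
apply: (latent_law_gt0 Mwf Nwf p_density px_density pxhat_density matching
  (c := p v (h z) / 2)) => //.
- exact: compact_cube.
- exists z; apply: filterS (@ball_cube _ _ z e) _; exact: nbhsx_ballx.
- by rewrite divr_gt0.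
by move=> y /H -/(_ ee0)[].
Qed.

(** Were the ratio of [u] to [v] smaller at [z] than at [z'], two constants [a < b] would fit
    between. Small cubes of equal radius about [z] and [z'] share their changing masses [S'] (for
    [u]) and [S] (for [v]). Their invariant masses are the same in both domains and cancel, leaving
    [S' <= a * S] and [b * S <= S'], which is absurd for [S > 0]. *)
Lemma density_ratio_le u v z z' : lp_support N z -> lp_support N z' ->
  lsubmx z = lsubmx z' -> 0 < p v (h z) -> 0 < p v (h z') ->
  p u (h z') * p v (h z) <= p u (h z) * p v (h z').
Proof.
move=> Nz Nz' zz' pz pz'; rewrite leNgt; apply/negP => lt.
have pu0 y : lp_support N y -> 0 <= p u (h y).
  move=> Ny; have [_ + _] := p_density u; apply.
  exact: (latent_map_sub Mwf Nwf).
pose r := p u (h z) / p v (h z); pose r' := p u (h z') / p v (h z').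
have rr' : r < r' by rewrite /r /r' ltr_pdivrMr// mulrAC ltr_pdivlMr.
have r0 : 0 <= r by apply: divr_ge0; [exact: pu0|exact: ltW].
(* The points cutting [[r, r']] into thirds, so that [r < a < b < r']. *)
pose a := r + (r' - r) / 3; pose b := r' - (r' - r) / 3.
have ab : a < b by rewrite /a /b; lra.
have ra : r < a by rewrite /a; lra.
have br' : b < r' by rewrite /b; lra.
have a0 : 0 <= a by lra.
have b0 : 0 <= b by lra.
have n1 : \forall y \near z, 1 * p u (h y) <= a * p v (h y).
  by apply: near_density_lt => //; rewrite mul1r -ltr_pdivrMr.
have n2 : \forall y \near z', b * p v (h y) <= 1 * p u (h y).
  by apply: near_density_lt => //; rewrite mul1r -ltr_pdivlMr.
have [e1 e10 H1] := near_cube_mass Nz pz n1.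
have [e2 e20 H2] := near_cube_mass Nz' pz' n2.
(* A common radius makes the changing factors of the two cubes equal, since their centres have the
   same changing part. *)
pose e := Num.min e1 e2.
have e_gt0 : 0 < e by rewrite lt_min e10.
have ee1 : e <= e1 by rewrite ge_min lexx.
have ee2 : e <= e2 by rewrite ge_min lexx orbT.
have [N1 Q1 m1] := H1 e e_gt0 ee1.
have [N2 Q2 m2] := H2 e e_gt0 ee2.
have := latent_law_le Mwf Nwf p_density px_density pxhat_density matching
  (@compact_cube _ _ z e) N1 ler01 a0 Q1.
have := latent_law_le Mwf Nwf p_density px_density pxhat_density matching
  (@compact_cube _ _ z' e) N2 b0 ler01 Q2.
rewrite !(latent_cube N_indep) -!EFinM !lee_fin !mul1r -zz'.
rewrite (invariant_mass_domain Nwf u v) (invariant_mass_domain Nwf u v).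
rewrite -zz' in m2.
move: m1 m2 (changing_mass_ge0 N v (lsubmx z) e) (invariant_mass_ge0 N v (rsubmx z) e)
 (invariant_mass_ge0 N v (rsubmx z') e).
set S := changing_mass N v _ e; set C := invariant_mass N v _ e.
set C' := invariant_mass N v _ e; set S' := changing_mass N u _ e => m1 m2 S0 C0 C'0.
(* The cubes have positive mass in domain [v], so each factor is nonzero and may be cancelled. *)
have S_gt0 : 0 < S.
  by rewrite lt_neqAle S0 andbT; apply: contraTneq m1 => <-; rewrite mul0r ltxx.
have C_gt0 : 0 < C by rewrite -(pmulr_rgt0 _ S_gt0).
have C'_gt0 : 0 < C' by rewrite -(pmulr_rgt0 _ S_gt0).
rewrite !mulrA !ler_pM2r// => bS Sa.
have : b * S <= a * S by exact: le_trans bS Sa.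
by rewrite ler_pM2r// leNgt ab.
Qed.

Lemma density_ratio u v z z' : lp_support N z -> lp_support N z' ->
  lsubmx z = lsubmx z' -> 0 < p v (h z) -> 0 < p v (h z') ->
  p u (h z') * p v (h z) = p u (h z) * p v (h z').
Proof.
move=> Nz Nz' zz' pz pz'; apply/eqP; rewrite eq_le.
by rewrite !density_ratio_le.
Qed.

End density_ratio.

(** * Almost everywhere properties on the real line *)

Section almost_everywhere_real.
Context {R : realType}.

Lemma ae_nbhs_exists (x : R) (P : R -> Prop) (W : set R) :
  {ae lebesgue_measure, forall t : measurableTypeR R, P t} -> nbhs x W ->
  exists2 t, W t & P t.
Proof.
move=> [B [mB B0 PB]] /nbhs_ballP[e /= e0 xeW]; apply: contrapT => H.
have eB : `](x - e), (x + e)[%classic `<=` B.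
  move=> t; rewrite /= in_itv /= => /andP[t1 t2]; apply: PB => /= Pt; apply: H.
  exists t => //; apply: xeW; rewrite /ball /= ltr_norml.
  by apply/andP; split; lra.
pose I : set (measurableTypeR R) := `](x - e), (x + e)[%classic.
have : (lebesgue_measure I <= lebesgue_measure B)%E.
  by apply: le_measure; rewrite ?inE//; exact: measurable_itv.
rewrite B0 /I lebesgue_measure_itv /= lte_fin ifT; last lra.
by rewrite -EFinD lee_fin leNgt => /negP[]; clear -e0; lra.
Qed.

Lemma ae_eq_continuous (x : R) (f g : R -> R) :
  {ae lebesgue_measure, forall t : measurableTypeR R, f t = g t} ->
  {for x, continuous f} -> {for x, continuous g} -> f x = g x.
Proof.
move=> fg cf cg; apply: contrapT => /eqP fgx.
have cfg : {for x, continuous (fun t => f t - g t)}.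
  exact: continuousB.
have fgx' : f x - g x != 0 by rewrite subr_eq0.
have [t] := ae_nbhs_exists fg (cvgr_neq0 _ cfg fgx').
by move=> /[swap] ->; rewrite subrr eqxx.
Qed.

End almost_everywhere_real.

(** * Regularity of the marginal densities and domain invariance *)

Section marginal_densities.
Context (R : realType) (U : Type) (ns nc d : nat) (X : set 'rV[R]_d).
Variable M : latent_process R U ns nc d.
Hypothesis Mwf : well_formed M X.
Variable p : U -> 'rV[R]_(ns + nc) -> R.
Variable q : U -> 'I_(ns + nc) -> R -> R.
Hypothesis q_marginal : cond_marginal_density M q.
Hypothesis p_smooth : forall u, twice_differentiable_on (lp_support M) (p u).
Hypothesis p_prod : forall u z, lp_support M z ->
  p u z = \prod_(i < ns + nc) q u i (z ord0 i).

Lemma marginal_ge0 u i t : 0 <= q u i t.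
Proof. by have [_ + _] := q_marginal u i; apply. Qed.

(** Replaces coordinate [i] of [z] by [t], in affine form so that differentiability in [t] is
    immediate. *)
Let set_coord (z : 'rV[R]_(ns + nc)) i (t : R) : 'rV[R]_(ns + nc) :=
  (t - z ord0 i) *: delta_mx ord0 i + z.

Let set_coordE z i t j :
  set_coord z i t ord0 j = if j == i then t else z ord0 j.
Proof.
rewrite !mxE eqxx /=; case: eqVneq => [->|_]; rewrite ?mulr1 ?subrK//.
by rewrite mulr0 add0r.
Qed.

Let set_coord_id z i : set_coord z i (z ord0 i) = z.
Proof. by rewrite /set_coord subrr scale0r add0r. Qed.

Let differentiable_set_coord z i : differentiable (set_coord z i) (z ord0 i).
Proof.
apply: differentiableD => //; apply: differentiableZl.
exact: differentiableB.
Qed.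

Let near_set_coord z i : lp_support M z ->
  \forall t \near z ord0 i, lp_support M (set_coord z i t).
Proof.
move=> Mz; have oM : open (lp_support M) by have [] := Mwf.
apply: (differentiable_continuous (differentiable_set_coord z i)).
by rewrite set_coord_id; apply: open_nbhs_nbhs; split.
Qed.

(** Regularity comes from the joint density: with the other coordinates frozen, the product formula
    shows that the marginal is near [z ord0 i] the joint density divided by the constant [C], which
    is nonzero because [p u z] is. *)
Lemma marginal_derivable u z i : lp_support M z -> p u z != 0 ->
  derivable (q u i) (z ord0 i) 1.
Proof.
move=> Mz pz.
pose C := \prod_(j < ns + nc | j != i) q u j (z ord0 j).
have C0 : C != 0.
  apply: contraNneq pz => C0; rewrite p_prod// (bigD1 i)//= -/C C0 mulr0.
  by [].
apply: (@near_eq_derivable _ _ _ (fun t => C^-1 * p u (set_coord z i t))).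
  apply: filterS (near_set_coord i Mz) => t Mlt.
  rewrite /= p_prod// (bigD1 i)//= set_coordE eqxx.
  rewrite (eq_bigr (fun j => q u j (z ord0 j))) -/C; last first.
    by move=> j /negbTE ji; rewrite set_coordE ji.
  by rewrite mulrC mulfK.
apply/derivable1_diffP; apply: differentiableM => //.
apply: differentiable_comp; first exact: differentiable_set_coord.
rewrite set_coord_id; exact: (p_smooth _ Mz).1.
Qed.

Lemma marginal_continuous u z i : lp_support M z -> p u z != 0 ->
  {for z ord0 i, continuous (q u i)}.
Proof.
move=> Mz pz; apply: differentiable_continuous; apply/derivable1_diffP.
exact: marginal_derivable.
Qed.

Lemma marginal_near_continuous u z i : lp_support M z -> p u z != 0 ->
  \forall t \near z ord0 i, {for t, continuous (q u i)}.
Proof.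
move=> Mz pz.
have cp : {for z ord0 i, continuous (p u \o set_coord z i)}.
  apply: differentiable_continuous; apply: differentiable_comp.
    exact: differentiable_set_coord.
  by rewrite set_coord_id; exact: (p_smooth _ Mz).1.
have pz' : (p u \o set_coord z i) (z ord0 i) != 0 by rewrite /= set_coord_id.
apply: filterS2 (near_set_coord i Mz) (cvgr_neq0 _ cp pz') => t Mt pt.
have {1}<- : set_coord z i t ord0 i = t by rewrite set_coordE eqxx.
exact: marginal_continuous.
Qed.

(** Both functions are densities of one law, since an invariant component has the same law in every
    domain; equal integrals on all measurable sets give equality almost everywhere. *)
Lemma invariant_marginal_ae u v j :
  {ae lebesgue_measure, forall t : measurableTypeR R,
    q u (rshift ns j) t = q v (rshift ns j) t}.
Proof.
have qE w : lebesgue_measure.-integrable setT (EFin \o q w (rshift ns j)).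
  have [mq q0 qP] := q_marginal w (rshift ns j).
  apply/integrableP; split; first exact/measurable_EFinP.
  have -> : (\int[lebesgue_measure]_(x in setT) `|(EFin \o q w (rshift ns j)) x| =
      \int[lebesgue_measure]_(x in setT) (q w (rshift ns j) x)%:E)%E.
    by apply: eq_integral => t _; rewrite gee0_abs// lee_fin q0.
  have := qP setT measurableT; rewrite setTI => <-.
  by rewrite preimage_setT probability_setT ltry.
have [mq q0 qP] := q_marginal v (rshift ns j).
have [_ _ qP'] := q_marginal u (rshift ns j).
have mqv : measurable_fun setT (EFin \o q v (rshift ns j)).
  exact/measurable_EFinP.
have := integral_ae_eq measurableT (qE u) mqv.
have H : forall E : set (measurableTypeR R), E `<=` setT -> measurable E ->
    (\int[lebesgue_measure]_(x in E) (EFin \o q u (rshift ns j)) x =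
     \int[lebesgue_measure]_(x in E) (EFin \o q v (rshift ns j)) x)%E.
  move=> E _ mE; have := qP E mE; have := qP' E mE; rewrite setIT => <- <-.
  exact: (invariant_component Mwf).
move=> /(_ H).
by apply: filterS => t /(_ I) [].
Qed.

End marginal_densities.

(** * Log-density differences and the score matrix *)

Section score_differences.
Context (R : realType) (U : Type) (ns nc d : nat) (X : set 'rV[R]_d).
Variable M : latent_process R U ns nc d.
Hypothesis Mwf : well_formed M X.
Variable p : U -> 'rV[R]_(ns + nc) -> R.
Variable q : U -> 'I_(ns + nc) -> R -> R.
Hypothesis q_marginal : cond_marginal_density M q.
Hypothesis p_smooth : forall u, twice_differentiable_on (lp_support M) (p u).
Hypothesis p_prod : forall u z, lp_support M z ->
  p u z = \prod_(i < ns + nc) q u i (z ord0 i).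

Lemma marginal_gt0 u z i : lp_support M z -> p u z != 0 -> 0 < q u i (z ord0 i).
Proof.
move=> Mz pz; rewrite lt_neqAle (marginal_ge0 q_marginal) andbT.
apply: contraNneq pz => qz; rewrite p_prod//.
by apply/prodf_eq0; exists i => //; rewrite -qz.
Qed.

Lemma ln_prod n (F : 'I_n -> R) : (forall i, 0 < F i) ->
  ln (\prod_(i < n) F i) = \sum_(i < n) ln (F i).
Proof.
move=> F0; suff [] : 0 < \prod_(i < n) F i /\
    ln (\prod_(i < n) F i) = \sum_(i < n) ln (F i) by [].
elim/big_ind2 : _ => [|x1 x2 y1 y2 [x0 <-] [y0 <-]|i _].
- by rewrite ln1.
- by rewrite mulr_gt0// lnM// posrE.
- by [].
Qed.

(** Invariant marginals of two domains agree almost everywhere and are continuous near the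
    coordinates of [z], hence agree there exactly; their logarithms cancel and only the changing
    components remain. *)
Lemma near_log_density_ratio u v z : lp_support M z ->
  p u z != 0 -> p v z != 0 ->
  \forall y \near z, lp_support M y -> p u y != 0 -> p v y != 0 ->
    ln (p u y) - ln (p v y) =
    \sum_(i < ns) (ln (q u (lshift nc i) (y ord0 (lshift nc i))) -
                   ln (q v (lshift nc i) (y ord0 (lshift nc i)))).
Proof.
move=> Mz pu pv.
have qj (j : 'I_nc) : \forall y \near (z : 'rV[R]_(ns + nc)),
    q u (rshift ns j) ((y : 'rV[R]_(ns + nc)) ord0 (rshift ns j)) =
    q v (rshift ns j) ((y : 'rV[R]_(ns + nc)) ord0 (rshift ns j)).
  have nc1 := marginal_near_continuous Mwf p_smooth p_prod (rshift ns j) Mz pu.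
  have nc2 := marginal_near_continuous Mwf p_smooth p_prod (rshift ns j) Mz pv.
  have E : \forall t \near z ord0 (rshift ns j),
      q u (rshift ns j) t = q v (rshift ns j) t.
    apply: filterS2 nc1 nc2 => t c1 c2.
    exact: (ae_eq_continuous (invariant_marginal_ae Mwf q_marginal u v j)).
  exact: (@coord_continuous R 1 _ ord0 (rshift ns j) z _ E).
have : \forall y \near z, forall j : 'I_nc,
    q u (rshift ns j) ((y : 'rV[R]_(ns + nc)) ord0 (rshift ns j)) =
    q v (rshift ns j) ((y : 'rV[R]_(ns + nc)) ord0 (rshift ns j)).
  exact: (filter_forall (nbhs_filter z) qj).
apply: filterS => y qy My puy pvy.
rewrite !p_prod//.
rewrite !ln_prod; [|by move=> i; exact: marginal_gt0|by move=> i; exact: marginal_gt0].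
rewrite !big_split_ord /= opprD addrACA sumrB.
rewrite [X in _ + X](_ : _ = 0) ?addr0//.
by rewrite -sumrB big1// => j _; rewrite qy subrr.
Qed.

(** The fourth assumption makes the changing marginals positive but says nothing about the invariant
    ones at [z]. The score matrix depends only on the changing part, so the invariant coordinates
    may be moved slightly, within [V], to values where all domains are positive. *)
Lemma exists_unit_score_difference (V : set 'rV[R]_(ns + nc))
    (A1 : (lebesgue_rV R (ns + nc)).-negligible
      [set z | lp_support M z /\ forall u : U, p u z = 0])
    (A4 : forall zs : 'rV[R]_ns, changing_support M zs ->
      exists dom : 'I_ns.+1 -> U,
        (forall (k : 'I_ns.+1) (i : 'I_ns),
           0 < q (dom k) (lshift nc i) (zs ord0 i)) /\
        score_difference q dom zs \in unitmx) :
  open V -> V !=set0 -> V `<=` lp_support M ->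
  exists z (dom : 'I_ns.+1 -> U), [/\ V z,
    score_difference q dom (lsubmx z) \in unitmx & forall k, 0 < p (dom k) z].
Proof.
move=> oV V0 VM; have [z Vz Nz] := negligible_open_rV A1 oV V0.
have Mz := VM _ Vz.
have [u pu] : exists u, p u z != 0.
  apply: contrapT => H; apply: Nz; split=> // u.
  by apply: contrapT => /eqP pu; apply: H; exists u.
have [|dom [q0 sd]] := A4 (lsubmx z); first by exists z.
have [e e0 zeV] := nbhs_cube (open_nbhs_nbhs (conj oV Vz)).
(* Near its value at [z] the marginal for [u] is positive by continuity, and at almost every point
   it equals the marginals of the finitely many domains [dom k]. *)
have tP (j : 'I_nc) : exists t, `|z ord0 (rshift ns j) - t| < e /\
    forall k, 0 < q (dom k) (rshift ns j) t.
  pose r := rshift ns j.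
  have ae k : {ae lebesgue_measure, forall t : measurableTypeR R,
      q (dom k) r t = q u r t}.
    exact: (invariant_marginal_ae Mwf q_marginal).
  have ae' : {ae lebesgue_measure, forall t : measurableTypeR R,
      forall k, q (dom k) r t = q u r t}.
    exact: filter_forall.
  have qz : 0 < q u r (z ord0 r) by exact: marginal_gt0.
  have cq := marginal_continuous Mwf p_smooth p_prod (i := r) Mz pu.
  have n1 : \forall t \near z ord0 r, 0 < q u r t by exact: cvgr_gt cq _ qz.
  have n2 : \forall t \near z ord0 r, `|z ord0 r - t| < e.
    by apply/nbhs_ballP; exists e.
  have [t [t1 t2] t3] := ae_nbhs_exists ae' (filterI n1 n2).
  by exists t; split=> // k; rewrite t3.
have [t tE] := choice tP.
pose z' : 'rV[R]_(ns + nc) := row_mx (lsubmx z) (\row_j t j).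
have Vz' : V z'.
  apply: (zeV e (lexx e)); apply: ball_cube; apply/rV_ballE; split=> // i.
  rewrite /z'; case: (split_ordP i) => j ->.
    by rewrite row_mxEl mxE subrr normr0.
  by rewrite row_mxEr mxE; have [] := tE j.
exists z', dom; split; [exact: Vz'|by rewrite /z' row_mxKl|move=> k].
rewrite p_prod; last exact: VM.
apply: prodr_gt0 => i _; rewrite /z'; case: (split_ordP i) => j ->.
  by rewrite row_mxEl.
by rewrite row_mxEr mxE; have [] := tE j.
Qed.

Lemma marginal_ln_derive u z i : lp_support M z -> p u z != 0 ->
  is_derive (z ord0 i) (1 : R) (fun t => ln (q u i t))
    (derive1 (fun t => ln (q u i t)) (z ord0 i)).
Proof.
move=> Mz pz; have dq := marginal_derivable Mwf p_smooth p_prod (i := i) Mz pz.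
have dl := is_derive1_comp (is_derive1_ln (marginal_gt0 i Mz pz)) (derivableP dq).
by apply: DeriveDef; [exact: ex_derive|rewrite derive1E].
Qed.

End score_differences.

(** * Derivatives of [h] in invariant directions *)

Lemma derive_line (R : realType) (V W : normedModType R) (f : V -> W) x v :
  'D_v f x = 'D_1 (fun t : R => f (t *: v + x)) 0.
Proof.
rewrite /derive; set g1 := fun t => t^-1 *: _; set g2 := fun t => t^-1 *: _.
suff -> : g1 = g2 by [].
by apply/funext => t; rewrite /g1 /g2 /= addr0 scale0r add0r [_%:A]mulr1.
Qed.

Section identification.
Context (R : realType) (U : Type) (ns nc d : nat) (X : set 'rV[R]_d).
Variables M N : latent_process R U ns nc d.
Hypotheses (Mwf : well_formed M X) (Nwf : well_formed N X).
Variable p : U -> 'rV[R]_(ns + nc) -> R.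
Variable q : U -> 'I_(ns + nc) -> R -> R.
Hypothesis p_density : cond_density M p.
Hypothesis q_marginal : cond_marginal_density M q.
Hypothesis p_smooth : forall u, twice_differentiable_on (lp_support M) (p u).
Hypothesis p_prod : forall u z, lp_support M z ->
  p u z = \prod_(i < ns + nc) q u i (z ord0 i).
Hypothesis N_indep : forall u, cond_independent N u.
Variable mu : {measure set 'rV[R]_d -> \bar R}.
Variables px pxhat : U -> 'rV[R]_d -> R.
Hypothesis px_density : observed_density M mu X px.
Hypothesis pxhat_density : observed_density N mu X pxhat.
Hypothesis matching : forall (x : 'rV[R]_d) (u : U), X x -> px u x = pxhat u x.

Let h := latent_map M N.

Lemma latent_map_is_derive_line z w i : lp_support N z ->
  is_derive (0 : R) (1 : R) (fun t : R => h (t *: w + z) ord0 i)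
    (('D_w h z) ord0 i).
Proof.
move=> Nz; have [_ dh _] := latent_map_C1 Mwf Nwf Nz.
have dhz : derivable h z w := nbhs_singleton (dh w).
have /derivable_mxP/(_ ord0 i)/derivable1P dhi := dhz.
apply: DeriveDef => //; rewrite (derive_mx dhz) mxE.
exact/esym/derive_line.
Qed.

(** Along the line [l] the changing part of the estimated latent is fixed, so the log ratio of the
    densities at [h (l t)] is constant near [t = 0]. It is also a sum of functions of the changing
    components of [h (l t)], and the chain rule at [0] gives the left-hand side. *)
Lemma score_difference_mul_derive z (dom : 'I_ns.+1 -> U) w k :
  lp_support N z -> (forall k, 0 < p (dom k) (h z)) -> lsubmx w = 0 ->
  \sum_(i < ns) score_difference q dom (lsubmx (h z)) k i *
    ('D_w h z) ord0 (lshift nc i) = 0.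
Proof.
move=> Nz pz w0.
pose l (t : R) := t *: w + z; pose u := dom (lift ord0 k); pose v := dom ord0.
have Mhz := latent_map_sub Mwf Nwf Nz.
have pz0 k' : p (dom k') (h z) != 0 by rewrite gt_eqF.
have l0 : l 0 = z by rewrite /l scale0r add0r.
have cl : {for 0, continuous l}.
  by apply: differentiable_continuous; apply: differentiableD.
have nl (P : set 'rV[R]_(ns + nc)) : nbhs z P -> \forall t \near (0 : R), P (l t).
  by rewrite -l0 => /cl.
have nN : nbhs z (lp_support N).
  by apply: open_nbhs_nbhs; split=> //; have [] := Nwf.
pose F i s := ln (q u (lshift nc i) s) - ln (q v (lshift nc i) s).
have Fcst : \forall t \near (0 : R),
    \sum_(i < ns) F i (h (l t) ord0 (lshift nc i)) =
    ln (p u (h z)) - ln (p v (h z)).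
  have n1 := near_log_density_ratio Mwf q_marginal p_smooth p_prod Mhz
    (pz0 (lift ord0 k)) (pz0 ord0).
  have n2 := latent_map_continuous Mwf Nwf Nz n1.
  have n3 k' := near_density_gt0 Mwf Nwf p_smooth Nz (pz k').
  have nI := @filterI _ _ (nbhs_filter z).
  have n4 := nI _ _ (nI _ _ nN n2) (nI _ _ (n3 (lift ord0 k)) (n3 ord0)).
  apply: filterS (nl _ n4) => t [[Nlt /= E] [pu pv]].
  have pu0 : 0 < p u (h (l t)) by apply: lt_le_trans pu; rewrite divr_gt0.
  have pv0 : 0 < p v (h (l t)) by apply: lt_le_trans pv; rewrite divr_gt0.
  have Mlt := latent_map_sub Mwf Nwf Nlt.
  rewrite -E ?gt_eqF// -/u -/v.
  (* The direction [w] has no changing part, so the density ratio at [l t] can be compared with that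
     at [z]. *)
  have lsub : lsubmx z = lsubmx (l t) by rewrite /l linearD linearZ/= w0 scaler0 add0r.
  have := density_ratio Mwf Nwf p_density p_smooth N_indep px_density
    pxhat_density matching u Nz Nlt lsub (pz ord0) pv0.
  rewrite -/h -/v => /(congr1 (@ln R)).
  rewrite !lnM ?posrE ?pz// => H.
  apply/eqP; rewrite subr_eq addrAC eq_sym subr_eq eq_sym.
  by apply/eqP; rewrite H addrC.
have dF : is_derive (0 : R) (1 : R)
    (\sum_(i < ns) (fun t => F i (h (l t) ord0 (lshift nc i))))
    (\sum_(i < ns) score_difference q dom (lsubmx (h z)) k i *
      ('D_w h z) ord0 (lshift nc i)).
  apply: is_derive_sum => i; apply: (@is_derive1_comp R (F i)); last first.
    exact: latent_map_is_derive_line.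
  rewrite -/(l 0) l0 mxE mxE.
  by apply: is_deriveB;
    exact: (marginal_ln_derive Mwf q_marginal p_smooth p_prod _ Mhz (pz0 _)).
(* The sum is the derivative at [0] of a function that is constant near [0]. *)
have [_ <-] := dF.
rewrite -[RHS](derive_cst (ln (p u (h z)) - ln (p v (h z))) (0 : R) (1 : R)).
apply: near_eq_derive; apply: filterS Fcst => t /= <-.
by rewrite fct_sumE.
Qed.

Lemma derive_latent_map_unit_score z (dom : 'I_ns.+1 -> U) w :
  lp_support N z -> (forall k, 0 < p (dom k) (h z)) ->
  score_difference q dom (lsubmx (h z)) \in unitmx -> lsubmx w = 0 ->
  forall i, ('D_w h z) ord0 (lshift nc i) = 0.
Proof.
move=> Nz pz sd w0 i.
pose D : 'cV[R]_ns := \col_i ('D_w h z) ord0 (lshift nc i).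
have sdD : score_difference q dom (lsubmx (h z)) *m D = 0.
  apply/colP => k; rewrite !mxE.
  rewrite -[RHS](score_difference_mul_derive k Nz pz w0).
  by apply: eq_bigr => j _; rewrite [X in _ * X]mxE.
have := mulKmx sd D; rewrite sdD mulmx0 => /colP/(_ i).
by rewrite !mxE => <-.
Qed.

(** A nonzero derivative at [z] would stay nonzero on an open set [V]. Its image under [h] is open,
    so it contains a point with positive densities and invertible score matrix, where the derivative
    vanishes. *)
Lemma derive_latent_map_eq0 z w i
    (A1 : (lebesgue_rV R (ns + nc)).-negligible
      [set z | lp_support M z /\ forall u : U, p u z = 0])
    (A4 : forall zs : 'rV[R]_ns, changing_support M zs ->
      exists dom : 'I_ns.+1 -> U,
        (forall (k : 'I_ns.+1) (i : 'I_ns),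
           0 < q (dom k) (lshift nc i) (zs ord0 i)) /\
        score_difference q dom zs \in unitmx) :
  lp_support N z -> lsubmx w = 0 -> ('D_w h z) ord0 (lshift nc i) = 0.
Proof.
move=> Nz w0; apply: contrapT => /eqP Dz.
have [_ _ cD] := latent_map_C1 Mwf Nwf Nz.
have cDi : {for z, continuous (fun y => ('D_w h y) ord0 (lshift nc i))}.
  exact: (continuous_comp (cD w) (@coord_continuous R 1 _ ord0 (lshift nc i) _)).
have nN : nbhs z (lp_support N).
  by apply: open_nbhs_nbhs; split=> //; have [] := Nwf.
have nD : nbhs z (fun y => ('D_w h y) ord0 (lshift nc i) != 0).
  exact: cvgr_neq0 _ cDi Dz.
pose V := (lp_support N `&` (fun y => ('D_w h y) ord0 (lshift nc i) != 0))°.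
have oV : open V by exact: open_interior.
have VN : V `<=` lp_support N by move=> y /interior_subset[].
have ohV := latent_map_open Mwf Nwf oV VN.
have hVM : h @` V `<=` lp_support M.
  by move=> _ [y /VN Ny <-]; exact: (latent_map_sub Mwf Nwf).
have hV0 : h @` V !=set0 by exists (h z), z => //; exact: filterI.
have [_ [dom [[y Vy <-] sd py]]] :=
  exists_unit_score_difference Mwf q_marginal p_smooth p_prod A1 A4 ohV hV0 hVM.
have [_ /eqP] := interior_subset Vy; apply.
exact: (derive_latent_map_unit_score (VN _ Vy) py sd w0).
Qed.

End identification.

(** * Constancy of [h] along the fibres of the changing part *)

Lemma connected_locally_constant (T : topologicalType) (V : Type) (A : set T)
    (f : T -> V) : connected A ->
  (forall x, A x -> \forall y \near x, f y = f x) ->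
  forall x y, A x -> A y -> f x = f y.
Proof.
move=> cA lf x y Ax Ay.
have : A `&` [set z | f z = f x] = A.
  apply: cA; first by exists x.
    exists [set z | f z = f x]°; first exact: open_interior.
    apply/seteqP; split=> z [Az fz]; split=> //; last exact: interior_subset fz.
    by apply: filterS (lf _ Az) => t /= ->.
  (* The other level sets are open relative to [A] as well, so this level set is also closed
     relative to [A]. *)
  exists (~` [set z | f z <> f x]°); first exact/open_closedC/open_interior.
  apply/seteqP; split=> z [Az fz]; split=> //.
    by move=> /interior_subset; exact.
  apply: contrapT => fzx; apply: fz.
  by apply: filterS (lf _ Az) => t /= ->.
by move=> /seteqP[_ /(_ _ Ay)[_ /= ->]].
Qed.

Lemma ball_segment (R : realType) (V : normedModType R) (x y : V) e t :
  ball x e y -> 0 <= t <= 1 -> ball x e (t *: (y - x) + x).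
Proof.
rewrite -ball_normE /= => xy /andP[t0 t1].
rewrite opprD addrCA subrr addr0 normrN normrZ ger0_norm//.
by apply: le_lt_trans xy; rewrite distrC ler_piMl.
Qed.

Section fibres.
Context (R : realType) (U : Type) (ns nc d : nat) (X : set 'rV[R]_d).
Variables M N : latent_process R U ns nc d.
Hypotheses (Mwf : well_formed M X) (Nwf : well_formed N X).

Let h := latent_map M N.

(** A fibre need not be convex, but the support contains a ball about each of its points; the mean
    value theorem on segments of that ball gives local constancy, and connectedness makes it
    global. *)
Lemma latent_map_constant_on_fibre (i : 'I_(ns + nc)) z z' :
  (forall zs : 'rV[R]_ns,
     connected [set zc : 'rV[R]_nc | lp_support N (row_mx zs zc)]) ->
  (forall y w, lp_support N y -> lsubmx w = 0 -> ('D_w h y) ord0 i = 0) ->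
  lp_support N z -> lp_support N z' -> lsubmx z = lsubmx z' ->
  h z ord0 i = h z' ord0 i.
Proof.
move=> conn D0 Nz Nz' zz'; rewrite -(hsubmxK z) -(hsubmxK z') -zz'.
pose f (zc : 'rV[R]_nc) := h (row_mx (lsubmx z) zc) ord0 i.
apply: (connected_locally_constant (conn (lsubmx z)) (f := f)); last 2 first.
- by rewrite /= hsubmxK.
- by rewrite /= zz' hsubmxK.
move=> zc /= Nzc; have oN : open (lp_support N) by have [] := Nwf.
have /nbhs_ballP[e /= e0 eN] := open_nbhs_nbhs (conj oN Nzc).
apply/nbhs_ballP; exists e => // zc' zc'e.
set y := row_mx (lsubmx z) zc in Nzc eN; pose y' := row_mx (lsubmx z) zc'.
have yy' : ball y e y'.
  move/rV_ballE : zc'e => [_ zc'e]; apply/rV_ballE; split=> // j.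
  rewrite /y /y'; case: (split_ordP j) => k ->.
    by rewrite !row_mxEl subrr normr0.
  by rewrite !row_mxEr.
pose w := y' - y.
have w0 : lsubmx w = 0 by rewrite /w linearB/= !row_mxKl subrr.
pose g (t : R) : R := h (t *: w + y) ord0 i.
have dg (t : R) : 0 <= t <= 1 -> is_derive t (1 : R) g 0.
  move=> t01; have Nt : lp_support N (t *: w + y).
    by apply: eN; exact: ball_segment.
  have := latent_map_is_derive_line Mwf Nwf w i Nt.
  (* The derivative is known at parameter [0] of the line based at [t *: w + y]; the shift by [t]
     moves it to parameter [t] of [g]. *)
  rewrite (D0 _ _ Nt w0) -{1}(subrr t) => dgt.
  have := @is_derive1_comp R _ (center t) t 0 1 dgt (is_derive_shift t 1 (- t)).
  rewrite mul0r; congr (is_derive _ _ _ _); apply/funext => s /=.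
  by rewrite /g addrA -scalerDl subrK.
have [||c c01] := @MVT_segment R g (cst 0) 0 1 ler01.
- by move=> t; rewrite in_itv /= => /andP[t0 t1]; apply: dg; rewrite !ltW.
- apply: derivable_within_continuous => t; rewrite in_itv /= => t01.
  by have [] := dg _ t01.
rewrite mul0r /g scale1r scale0r add0r subrK => /eqP.
by rewrite subr_eq0 => /eqP.
Qed.

End fibres.

(** * Subspace identifiability of the changing variables *)

Theorem theorem1 (R : realType) (U : Type) (ns nc d : nat)
  (dim_obs : (ns + nc <= d)%N)
  (X : set 'rV[R]_d)
  (M : latent_process R U ns nc d)
  (M_wf : well_formed M X)
  (M_shift : forall u v : U, u <> v ->
     exists B : set 'rV[R]_ns, measurable B /\
       lp_prob M u (changing u @^-1` B) <> lp_prob M v (changing v @^-1` B))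
  (p : U -> 'rV[R]_(ns + nc) -> R)
  (p_density : cond_density M p)
  (q : U -> 'I_(ns + nc) -> R -> R)
  (q_marginal : cond_marginal_density M q)
  (A1 : (lebesgue_rV R (ns + nc)).-negligible
     [set z | lp_support M z /\ forall u : U, p u z = 0])
  (A2 : forall u : U, twice_differentiable_on (lp_support M) (p u))
  (A3 : forall u : U, cond_independent M u /\
     forall z, lp_support M z -> p u z = \prod_(i < ns + nc) q u i (z ord0 i))
  (A4 : forall zs : 'rV[R]_ns, changing_support M zs ->
     exists dom : 'I_ns.+1 -> U,
       (forall (k : 'I_ns.+1) (i : 'I_ns),
          0 < q (dom k) (lshift nc i) (zs ord0 i)) /\
       score_difference q dom zs \in unitmx)
  (Mhat : latent_process R U ns nc d)
  (Mhat_wf : well_formed Mhat X)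
  (Mhat_indep : forall u : U, cond_independent Mhat u)
  (Mhat_connected : forall zs : 'rV[R]_ns,
     connected [set zc : 'rV[R]_nc | lp_support Mhat (row_mx zs zc)])
  (mu : {measure set 'rV[R]_d -> \bar R})
  (px pxhat : U -> 'rV[R]_d -> R)
  (px_density : observed_density M mu X px)
  (pxhat_density : observed_density Mhat mu X pxhat)
  (matching : forall (x : 'rV[R]_d) (u : U), X x -> px u x = pxhat u x) :
  forall i : 'I_ns, exists h_i : 'rV[R]_ns -> R,
    forall zhat : 'rV[R]_(ns + nc), lp_support Mhat zhat ->
      latent_map M Mhat zhat ord0 (lshift nc i) = h_i (lsubmx zhat).
Proof.
have [oN _ _ _ _] := Mhat_wf.
have p_prod u z : lp_support M z -> p u z = \prod_(i < ns + nc) q u i (z ord0 i).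
  by have [_ +] := A3 u; apply.
move=> i.
pose fibre (zs : 'rV[R]_ns) : set 'rV[R]_(ns + nc) :=
  [set z | lp_support Mhat z /\ lsubmx z = zs].
(* Evaluates [h] at a chosen point of the fibre over [zs]. The default [0] is used only when the
   fibre is empty, which never happens over the changing part of a point of the support. *)
exists (fun zs => latent_map M Mhat (xget 0 (fibre zs)) ord0 (lshift nc i)).
move=> zhat Nz; have /xgetPex : exists z, fibre (lsubmx zhat) z by exists zhat.
move=> /(_ 0)[Nz' zz'].
apply: (latent_map_constant_on_fibre M_wf Mhat_wf) => // y w Ny w0.
exact: (derive_latent_map_eq0 M_wf Mhat_wf p_density q_marginal A2 p_prod
  Mhat_indep px_density pxhat_density matching _ A1 A4 Ny w0).
Qed.
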